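(* Let $n$ be a positive integer, and let $S(n)$ denote the number of square-free positive integers less than or equal to $n$. Let $I$ be a positive integer satisfying $I\le\sqrt[3]{n/4}$. Let $x_i=\left\lfloor\sqrt{n/i}\right\rfloor$ for $i=1,\ldots,I$ and let $D=x_I$. Then $S(n)=S_1(n)+S_2(n)$, where $$S_1(n)=\sum_{d=1}^{D}\mu(d)\left\lfloor\frac{n}{d^2}\right\rfloor,\qquad S_2(n)=\left(\sum_{i=1}^{I-1}M(x_i)\right)-(I-1)M(x_I).$$
   Context: A positive integer is square-free if it is not divisible by the square of any integer greater than one. $\mu$ is the Möbius function. $M$ is the Mertens function, $M(x)=\sum_{1\le i\le x}\mu(i)=\sum_{i=1}^{\lfloor x\rfloor}\mu(i)$. *)

(* Defs.v *)
From HB Require Import structures.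
From mathcomp Require Import all_boot all_order all_algebra.
From mathcomp Require Import reals exp.
Set Implicit Arguments.
Unset Strict Implicit.
Unset Printing Implicit Defensive.
Import Order.TTheory GRing.Theory Num.Theory.
Local Open Scope ring_scope.

(* The bound d <= m only makes the predicate boolean: see squarefreeP.
   0 is not square-free. *)
Definition squarefree (m : nat) : bool :=
  (0 < m)%N && [forall d : 'I_m.+1, (1 < d)%N ==> ~~ (d ^ 2 %| m)%N].

Lemma squarefreeP (m : nat) :
  reflect ((0 < m)%N /\ forall d : nat, (1 < d)%N -> ~~ (d ^ 2 %| m)%N)
          (squarefree m).
Proof.
apply: (iffP andP) => [[m0 /forallP H]|[m0 H]]; split=> //; last first.
  by apply/forallP => d; apply/implyP => /H.
move=> d d1; apply/negP => dm.
have le_dm : (d < m.+1)%N.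
  rewrite ltnS (leq_trans _ (dvdn_leq m0 dm)) //.
  by rewrite -{1}(expn1 d) leq_exp2l.
by move: (H (Ordinal le_dm)); rewrite /= d1 dm.
Qed.

Definition squarefree_count (n : nat) : nat :=
  #|[pred m : 'I_n.+1 | squarefree m]|.

(* primes m lists the distinct prime divisors of m. *)
Definition mobius (m : nat) : int :=
  if squarefree m then (-1) ^+ size (primes m) else 0.

(* Num.truncn x is the floor of x for x >= 0, and 0 for x < 0. *)
Definition mertens (R : realType) (x : R) : int :=
  \sum_(1 <= i < (Num.truncn x).+1) mobius i.

(* Main.v *)
Require Import Defs.
From HB Require Import structures.
From mathcomp Require Import all_boot all_order all_algebra.
From mathcomp Require Import reals exp.
Set Implicit Arguments.
Unset Strict Implicit.
Unset Printing Implicit Defensive.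
Import Order.TTheory GRing.Theory Num.Theory.
Local Open Scope ring_scope.

(** Both sides count with the weights [mobius d].

    Since [\sum_(d | d ^ 2 %| m) mobius d] is 1 when [m] is square-free and 0
    otherwise, summing over [m <= n] and exchanging the two sums gives Legendre's
    formula: the number of square-free [m <= n] is
    [\sum_(d <= n) mobius d * (n %/ d ^ 2)] ([squarefree_count_legendre]).
    The indicator formula ([sum_mobius_square_dvd]) is proved by cancellation:
    if [p ^ 2 %| m] for some prime [p], the terms [d] and [p * d] with [d] prime
    to [p] are opposite, and the terms divisible by [p ^ 2] vanish.

    The terms [d <= D] of this formula are S1. When [d > D], that is,
    [d ^ 2 * I > n], the quotient [n %/ d ^ 2] is the number of [i] with
    [d ^ 2 * i <= n], all of which are smaller than [I]. Since [d ^ 2 * i <= n]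
    means [d <= x i] ([leq_truncn_sqrt]), exchanging the sums over [d] and [i]
    turns the tail into the sum over [i < I] of the [mobius d] with
    [x I < d <= x i], which is [M(x i) - M(x I)]; this is S2. *)

(** * Square-free numbers and the Möbius function *)

Lemma squarefree_primeP (m : nat) :
  reflect ((0 < m)%N /\ forall p : nat, prime p -> ~~ (p ^ 2 %| m)%N)
          (squarefree m).
Proof.
apply: (iffP (squarefreeP m)) => -[m0 H]; split=> // d.
  by move=> /prime_gt1; apply: H.
move=> d1; apply: contra (H _ (pdiv_prime d1)).
exact/dvdn_trans/dvdn_exp2r/pdiv_dvd.
Qed.

Lemma sqr_prime_mul_dvd (p e m : nat) : prime p -> (p ^ 2 %| m)%N ->
  ~~ (p %| e)%N -> ((p * e) ^ 2 %| m)%N = (e ^ 2 %| m)%N.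
Proof.
move=> pp p2m pe; rewrite expnMn Gauss_dvd ?p2m //.
by rewrite coprimeXl // coprimeXr // prime_coprime.
Qed.

(** Multiplying by a new prime keeps square-freeness and adds one prime factor;
    this sign change drives the cancellation below. *)
Lemma mobius_prime_mul_coprime (p e : nat) : prime p -> (0 < e)%N ->
  ~~ (p %| e)%N -> mobius (p * e) = - mobius e.
Proof.
move=> pp e0 pe; have p0 := prime_gt0 pp.
have -> : mobius (p * e) =
    if squarefree e then (-1) ^+ size (primes (p * e)) else 0.
  rewrite /mobius; congr (if _ then _ else _).
  apply/squarefree_primeP/squarefree_primeP => -[_ H]; split.
  - by [].
  - by move=> q /H; apply: contra => /(dvdn_mull p).
  - by rewrite muln_gt0 p0.
  move=> q qp; apply/negP => q2.
  have [qep|qnp] := eqVneq q p.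
    by move: q2; rewrite qep -mulnn dvdn_pmul2l // (negbTE pe).
  have cqp : coprime (q ^ 2) p.
    by rewrite coprimeXl // prime_coprime // dvdn_prime2.
  by move/negP: (H q qp); rewrite -(Gauss_dvdr _ cqp).
have pse : perm_eq (primes (p * e)) (p :: primes e).
  apply: uniq_perm; rewrite ?primes_uniq //=.
    by rewrite mem_primes (negbTE pe) !andbF primes_uniq.
  by move=> q; rewrite primesM // primes_prime // !inE.
rewrite (perm_size pse) /= exprS mulN1r /mobius.
by case: ifP => // _; rewrite oppr0.
Qed.

Lemma mobius_prime_mul_dvd (p e : nat) : prime p -> (p %| e)%N ->
  mobius (p * e) = 0.
Proof.
move=> pp pe; rewrite /mobius; case: squarefree_primeP => // -[_ /(_ p pp)].
by rewrite -mulnn dvdn_mul.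
Qed.

Lemma mobius1 : mobius 1 = 1.
Proof.
rewrite /mobius; case: squarefree_primeP => // -[]; split=> // p pp.
by rewrite dvdn1 -(exp1n 2) eqn_exp2r // gtn_eqF // prime_gt1.
Qed.

(** * Legendre's formula *)

(** For [e] prime to [p], the index [p * e] is admissible exactly when [e] is,
    because [p ^ 2 %| m], and its term is the opposite of that of [e]. Any other
    index is a multiple of [p ^ 2] and contributes 0. *)
Lemma sum_mobius_square_dvd_eq0 (p m : nat) :
  (0 < m)%N -> prime p -> (p ^ 2 %| m)%N ->
  \sum_(d < m.+1 | (d ^ 2 %| m)%N) mobius d = 0.
Proof.
move=> m0 pp p2m; have p0 := prime_gt0 pp.
have dvd_gt0 (d : nat) : (d ^ 2 %| m)%N -> (0 < d)%N.
  by case: d => //; rewrite dvd0n => /eqP m0'; rewrite m0' in m0.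
have dvd_le (d : nat) : (d ^ 2 %| m)%N -> (d <= m)%N.
  by rewrite -mulnn => dm; apply/dvdn_leq/(dvdn_trans _ dm)/dvdn_mulr.
rewrite (bigID (fun d : 'I_m.+1 => (p %| d)%N)) /=.
(* The multiples of p become p * e; inord sends p * e > m to 0, whose
   square does not divide m, so that no spurious index appears. *)
rewrite (reindex_onto (fun e : 'I_m.+1 => inord (p * e))
                      (fun d : 'I_m.+1 => inord (d %/ p))) /=; last first.
  move=> d /andP[_ pd].
  have dp : (d %/ p < m.+1)%N by apply: leq_ltn_trans (leq_div _ _) _.
  by rewrite [X in (p * X)%N]inordK // mulnC divnK // inord_val.
transitivity (\sum_(e < m.+1 | ((p * e) ^ 2 %| m)%N) mobius (p * e)
              + \sum_(d < m.+1 | (d ^ 2 %| m)%N && ~~ (p %| d)%N) mobius d).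
  congr (_ + _).
  apply: eq_big => [e|e /andP[/andP[e2 _] _]]; case: (leqP (p * e) m) => pem.
  - rewrite !inordK ?ltnS // dvdn_mulr // mulKn //=.
    by rewrite -val_eqE /= inordK // eqxx !andbT.
  - rewrite {1}/inord val_insubd ltnS leqNgt pem /= dvd0n eqn0Ngt m0 /=.
    by apply/esym/negbTE; apply: contraL pem => /dvd_le; rewrite -leqNgt.
  - by rewrite inordK.
  - move: e2; rewrite {1}/inord val_insubd ltnS leqNgt pem /=.
    by rewrite dvd0n eqn0Ngt m0.
rewrite (bigID (fun e : 'I_m.+1 => (p %| e)%N)) /= big1 ?add0r; last first.
  by move=> e /andP[_ pe]; rewrite mobius_prime_mul_dvd.
rewrite -[X in _ + X]opprK -sumrN; apply/eqP; rewrite subr_eq0; apply/eqP.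
apply: eq_big => e.
  by case pe: (p %| e)%N; rewrite ?andbF // sqr_prime_mul_dvd ?pe.
move=> /andP[e2 pe]; rewrite mobius_prime_mul_coprime // dvd_gt0 //.
by rewrite -(sqr_prime_mul_dvd pp).
Qed.

(** The range of [d] is the same for all [m <= N], so that the sums over [m] and
    [d] can be exchanged afterwards. *)
Lemma sum_mobius_square_dvd (m N : nat) : (0 < m <= N)%N ->
  \sum_(1 <= d < N.+1) mobius d * (d ^ 2 %| m)%N%:R = (squarefree m)%:R.
Proof.
move=> /andP[m0 mN].
have dvd0 : (0 ^ 2 %| m)%N = false by rewrite dvd0n eqn0Ngt m0.
have dvd_lt (d : nat) : (m < d)%N -> (d ^ 2 %| m)%N = false.
  move=> md; apply: contraTF md => dm; rewrite -leqNgt.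
  by apply: dvdn_leq => //; apply: dvdn_trans dm; rewrite -mulnn dvdn_mulr.
rewrite (big_cat_nat (n := m.+1)) //= [X in _ + X]big_nat.
rewrite [X in _ + X]big1 ?addr0; last first.
  by move=> d /andP[md _]; rewrite dvd_lt // mulr0.
case: (boolP (squarefree m)) => [/squarefreeP[_ sqm]|nsqm].
  rewrite big_ltn // dvd1n mulr1 mobius1 big_nat big1 ?addr0 // => d /andP[d1 _].
  by rewrite (negbTE (sqm d d1)) mulr0.
have [p pp p2m] : exists2 p, prime p & (p ^ 2 %| m)%N.
  move: nsqm; rewrite /squarefree m0 negb_forall => /existsP[d].
  rewrite negb_imply negbK => /andP[d1 d2m]; exists (pdiv d).
    exact: pdiv_prime.
  exact/(dvdn_trans _ d2m)/dvdn_exp2r/pdiv_dvd.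
rewrite -[RHS](sum_mobius_square_dvd_eq0 m0 pp p2m).
rewrite -(big_mkord (fun d => d ^ 2 %| m)%N mobius) [RHS]big_mkcond /=.
rewrite [RHS]big_ltn // dvd0 add0r; apply: eq_bigr => d _.
by case: ifP; rewrite ?mulr1 ?mulr0.
Qed.

(** A divisor [d ^ 2] is shared by [n %/ d ^ 2] of the integers in [[1, n]], which
    is its weight once the indicator formula is summed over them. *)
Lemma squarefree_count_legendre (n : nat) :
  (squarefree_count n)%:Z = \sum_(1 <= d < n.+1) mobius d * (n %/ d ^ 2)%N%:Z.
Proof.
have -> : (squarefree_count n)%:Z = \sum_(1 <= m < n.+1) (squarefree m)%:R.
  rewrite /squarefree_count -sum1_card.
  rewrite -(big_mkord squarefree (fun=> 1%N)) big_mkcond /=.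
  rewrite big_ltn //= add0n -natz natr_sum.
  by apply: eq_bigr => m _; case: ifP.
under eq_big_nat => m /sum_mobius_square_dvd <- do [].
rewrite exchange_big_nat /=; apply: eq_bigr => d _.
by rewrite -mulr_sumr divn_count_dvd -natr_sum natz.
Qed.

(** * Splitting the sum *)

(** The real bound [x i] encodes a condition on integers that can be read as a
    bound on [d] or as a bound on [i]: this is what the exchange rests on. *)
Lemma leq_truncn_sqrt (R : realType) (n i d : nat) : (0 < i)%N ->
  (d <= Num.truncn (Num.sqrt (n%:R / i%:R : R)))%N = (d ^ 2 * i <= n)%N.
Proof.
move=> i0; rewrite truncn_ge_nat ?sqrtr_ge0 //.
have i0' : 0 < i%:R :> R by rewrite ltr0n.
rewrite -(@ler_pXn2r _ 2) ?nnegrE ?sqrtr_ge0 ?ler0n //.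
rewrite sqr_sqrtr ?divr_ge0 ?ler0n // ler_pdivlMr //.
by rewrite -natrX -natrM ler_nat.
Qed.

Lemma mertens_natr (R : realType) (k : nat) :
  mertens (k%:R : R) = \sum_(1 <= d < k.+1) mobius d.
Proof. by rewrite /mertens natrK. Qed.

Theorem theorem2 (R : realType) (n : nat) (hn : (0 < n)%N)
    (I : nat) (hI : (0 < I)%N)
    (hIn : (I%:R : R) <= (n%:R / 4%:R) `^ (3%:R)^-1) :
  let x : nat -> nat :=
    fun i => Num.truncn (Num.sqrt (n%:R / i%:R : R)) in
  let D : nat := x I in
  let S1 : int := \sum_(1 <= d < D.+1) mobius d * (n %/ d ^ 2)%N%:Z in
  let S2 : int :=
    (\sum_(1 <= i < I) mertens ((x i)%:R : R))
      - (I%:Z - 1) * mertens ((x I)%:R : R) in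
  (squarefree_count n)%:Z = S1 + S2.
Proof.
move=> x D S1 S2.
have leq_x i d : (0 < i)%N -> (d <= x i)%N = (d ^ 2 * i <= n)%N.
  exact: leq_truncn_sqrt.
have x_le i : (0 < i)%N -> (x i <= n)%N.
  move=> i0; have := leqnn (x i); rewrite leq_x //; apply: leq_trans.
  by case: (x i) => // k; rewrite -mulnn -mulnA leq_pmulr // muln_gt0.
have D_le i : (0 < i < I)%N -> (D <= x i)%N.
  move=> /andP[i0 iI]; rewrite leq_x //.
  rewrite (leq_trans (leq_mul (leqnn _) (ltnW iI))) //.
  by rewrite -leq_x.
rewrite squarefree_count_legendre (big_cat_nat (n := D.+1)) //= ?ltnS ?x_le //.
congr (_ + _).
have -> : S2 = \sum_(1 <= i < I) \sum_(D.+1 <= d < (x i).+1) mobius d.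
  rewrite /S2 -/D; have -> : (I%:Z - 1) = (I - 1)%N%:R :> int.
    by rewrite natrB // natz.
  rewrite mulr_natl -sumr_const_nat -sumrB.
  apply: eq_big_nat => i iI; rewrite !mertens_natr.
  rewrite (big_cat_nat (m := 1%N) (n := D.+1) (p := (x i).+1)) ?ltnS ?D_le //=.
  by rewrite addrAC subrr add0r.
(* Beyond D, the quotient n %/ d ^ 2 counts the i < I with d <= x i. *)
transitivity (\sum_(D.+1 <= d < n.+1)
                \sum_(1 <= i < I) mobius d * (d <= x i)%N%:R).
  apply: eq_big_nat => d /andP[Dd _]; rewrite -mulr_sumr -natr_sum natz.
  congr (_ * _%:Z).
  have d2_gt0 : (0 < d ^ 2)%N by rewrite expn_gt0 (leq_trans _ Dd).
  have q_lt : (n %/ d ^ 2 < I)%N.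
    by rewrite ltn_divLR // mulnC ltnNge -leq_x // -ltnNge.
  (* For i < I, the inequality d <= x i holds exactly up to the quotient. *)
  rewrite [RHS](big_cat_nat (n := (n %/ d ^ 2).+1)) //=.
  rewrite [X in (_ + X)%N]big_nat [X in (_ + X)%N]big1 ?addn0; last first.
    move=> i /andP[qi _]; rewrite leq_x ?(leq_ltn_trans _ qi) //.
    by rewrite mulnC -leq_divRL // leqNgt qi.
  rewrite -[LHS](subn1 _.+1) -[LHS]muln1 -sum_nat_const_nat.
  apply: eq_big_nat => i /andP[i0 iq].
  by rewrite leq_x // mulnC -leq_divRL // -ltnS iq.
rewrite exchange_big_nat /=; apply: eq_big_nat => i iI.
have /andP[i0 _] := iI.
rewrite (big_cat_nat (n := (x i).+1)) /= ?ltnS ?D_le ?x_le //.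
rewrite [X in _ + X]big_nat [X in _ + X]big1 ?addr0; last first.
  by move=> d /andP[xd _]; rewrite leqNgt xd mulr0.
by apply: eq_big_nat => d /andP[_]; rewrite ltnS => ->; rewrite mulr1.
Qed.
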